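(* Let $X_1$ and $X_2$ be loops. The subdirect products of $X_1\times X_2$ are precisely the lifted isomorphism graphs in $X_1\times X_2$. Moreover, if $A=\mathbf G_{X_1/N_1,X_2/N_2}(\varphi)$ is a lifted isomorphism graph in $X_1\times X_2$ (with $N_1\unlhd X_1$, $N_2\unlhd X_2$ and $\varphi\colon X_1/N_1\to X_2/N_2$ an isomorphism), then $A\unlhd X_1\times X_2$ if and only if $X_1/N_1$ is abelian.
   Context: A loop is an algebra $(X,\cdot,\backslash,/,e)$ satisfying $x(x\backslash y)=y=x\backslash(xy)$, $(x/y)y=x=(xy)/y$ and $ex=xe=x$. Write $A\le X$ for subloops and $A\unlhd X$ for normal subloops (kernels of loop homomorphisms defined on $X$). A loop is abelian if it is an abelian group. A subloop $A\le X_1\times X_2$ is a subdirect product of $X_1\times X_2$ if both coordinate projections map $A$ onto $X_1$ and $X_2$, respectively. For $N_1\unlhd X_1$, $N_2\unlhd X_2$ and a mapping $\varphi\colon X_1/N_1\to X_2/N_2$, let $$\mathbf G_{X_1/N_1,X_2/N_2}(\varphi)=\{(x_1,x_2)\in X_1\times X_2:\varphi(x_1N_1)=x_2N_2\}.$$ A subset $A$ of $X_1\times X_2$ is a lifted isomorphism graph in $X_1\times X_2$ if there exist $N_1\unlhd X_1$, $N_2\unlhd X_2$ and a loop isomorphism $\varphi\colon X_1/N_1\to X_2/N_2$ such that $A=\mathbf G_{X_1/N_1,X_2/N_2}(\varphi)$. *)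

(* Defs.v *)
From HB Require Import structures.
From mathcomp Require Import all_boot.
From mathcomp Require Import boolp classical_sets.

Set Implicit Arguments.
Unset Strict Implicit.
Unset Printing Implicit Defensive.

Local Open Scope classical_set_scope.
Local Open Scope group_scope.

(* [ldiv x y] is x \ y and [rdiv x y] is x / y. *)
HB.mixin Record UMagma_isLoop X of UMagma X := {
  ldiv : X -> X -> X;
  rdiv : X -> X -> X;
  mulKld : forall x y : X, x * ldiv x y = y;
  ldivKm : forall x y : X, ldiv x (x * y) = y;
  rdivKm : forall x y : X, rdiv x y * y = x;
  mulKrd : forall x y : X, rdiv (x * y) y = x
}.

(* [UMagma] includes a choice structure; this is no restriction, since
   [boolp.gen_choiceMixin] provides one on every type. *)
#[short(type="loopType")]
HB.structure Definition Loop := {X of UMagma_isLoop X & UMagma X}.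

Section ProductLoop.
Variables X1 X2 : loopType.
Implicit Types p q : (X1 * X2)%type.

Definition prod_ldiv p q := (ldiv p.1 q.1, ldiv p.2 q.2).
Definition prod_rdiv p q := (rdiv p.1 q.1, rdiv p.2 q.2).

Fact prod_mulKld p q : p * prod_ldiv p q = q.
Proof. by case: p q => [x y] [z t]; congr pair; exact: mulKld. Qed.

Fact prod_ldivKm p q : prod_ldiv p (p * q) = q.
Proof. by case: p q => [x y] [z t]; congr pair; exact: ldivKm. Qed.

Fact prod_rdivKm p q : prod_rdiv p q * q = p.
Proof. by case: p q => [x y] [z t]; congr pair; exact: rdivKm. Qed.

Fact prod_mulKrd p q : prod_rdiv (p * q) q = p.
Proof. by case: p q => [x y] [z t]; congr pair; exact: mulKrd. Qed.

HB.instance Definition _ := UMagma_isLoop.Build (X1 * X2)%type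
  prod_mulKld prod_ldivKm prod_rdivKm prod_mulKrd.

End ProductLoop.

Definition subloop (X : loopType) (A : set X) : Prop :=
  [/\ A 1,
      forall x y, A x -> A y -> A (x * y),
      forall x y, A x -> A y -> A (ldiv x y)
    & forall x y, A x -> A y -> A (rdiv x y)].

Definition loop_morphism (X Y : loopType) (f : X -> Y) : Prop :=
  [/\ {morph f : x y / x * y},
      {morph f : x y / ldiv x y},
      {morph f : x y / rdiv x y}
    & f 1 = 1].

Definition loop_isomorphism (X Y : loopType) (f : X -> Y) : Prop :=
  loop_morphism f /\ bijective f.

Definition loop_kernel (X Y : loopType) (f : X -> Y) : set X :=
  [set x | f x = 1].

Definition normal_subloop (X : loopType) (N : set X) : Prop :=
  exists (Y : loopType) (f : X -> Y), loop_morphism f /\ N = loop_kernel f.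

Definition abelian_loop (X : loopType) : Prop :=
  associative (@mul X) /\ commutative (@mul X).

Record normalSubloop (X : loopType) := NormalSubloop {
  normal_set :> set X;
  normal_setP : normal_subloop normal_set
}.

Section QuotientLoop.
Variables (X : loopType) (N : normalSubloop X).
Implicit Types (x y z : X) (C D E : set X).

Definition coset x : set X := [set x * n | n in (N : set X)].

Record quotient_loop := QuotientLoop {
  quotient_set :> set X;
  quotient_setP : exists x, quotient_set = coset x
}.

HB.instance Definition _ := gen_eqMixin quotient_loop.
HB.instance Definition _ := gen_choiceMixin quotient_loop.

Fact quotient_set_inj : injective quotient_set.
Proof.
case=> [C CP] [D DP] /= CD; case: D / CD DP => DP.
by rewrite (Prop_irrelevance CP DP).
Qed.

(* The canonical projection x |-> xN. *)
Definition qproj x : quotient_loop :=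
  QuotientLoop (ex_intro (fun y => coset x = coset y) x erefl).

Fact qproj_surj (c : quotient_loop) : exists x, c = qproj x.
Proof.
have [x cx] := quotient_setP c.
by exists x; apply: quotient_set_inj.
Qed.

Fact coset_fiber (Y : loopType) (f : X -> Y) :
    loop_morphism f -> (N : set X) = loop_kernel f ->
  forall x, coset x = [set z | f z = f x].
Proof.
move=> [fM fL _ _] NE x; rewrite /coset NE; apply/seteqP; split=> z /=.
  by move=> [n fn <-]; rewrite fM fn mulg1.
move=> fz; exists (ldiv x z); last exact: mulKld.
by rewrite /loop_kernel /= fL fz -[X in ldiv _ X]mulg1 ldivKm.
Qed.

Fact coset_mul x y :
  [set c * d | c in coset x & d in coset y] = coset (x * y).
Proof.
have [Y [f [fP NE]]] := normal_setP N; have [fM fL fR _] := fP.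
rewrite !(coset_fiber fP NE); apply/seteqP; split=> z /=.
  by move=> [c fc [d fd <-]]; rewrite !fM fc fd.
move=> fz; exists x => //; exists (ldiv x z); last exact: mulKld.
by rewrite fL fz fM ldivKm.
Qed.

Fact coset_ldiv x y :
  [set ldiv c d | c in coset x & d in coset y] = coset (ldiv x y).
Proof.
have [Y [f [fP NE]]] := normal_setP N; have [fM fL fR _] := fP.
rewrite !(coset_fiber fP NE); apply/seteqP; split=> z /=.
  by move=> [c fc [d fd <-]]; rewrite !fL fc fd.
move=> fz; exists x => //; exists (x * z); last exact: ldivKm.
by rewrite fM fz fL mulKld.
Qed.

Fact coset_rdiv x y :
  [set rdiv c d | c in coset x & d in coset y] = coset (rdiv x y).
Proof.
have [Y [f [fP NE]]] := normal_setP N; have [fM fL fR _] := fP.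
rewrite !(coset_fiber fP NE); apply/seteqP; split=> z /=.
  by move=> [c fc [d fd <-]]; rewrite !fR fc fd.
move=> fz; exists (z * y); last by exists y => //; exact: mulKrd.
by rewrite fM fz fR rdivKm.
Qed.

Fact quotient_mul_in (c d : quotient_loop) :
  exists z, [set x * y | x in (c : set X) & y in (d : set X)] = coset z.
Proof.
have [[x ->] [y ->]] := (qproj_surj c, qproj_surj d).
by exists (x * y); rewrite /= coset_mul.
Qed.

Fact quotient_ldiv_in (c d : quotient_loop) :
  exists z, [set ldiv x y | x in (c : set X) & y in (d : set X)] = coset z.
Proof.
have [[x ->] [y ->]] := (qproj_surj c, qproj_surj d).
by exists (ldiv x y); rewrite /= coset_ldiv.
Qed.

Fact quotient_rdiv_in (c d : quotient_loop) :
  exists z, [set rdiv x y | x in (c : set X) & y in (d : set X)] = coset z.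
Proof.
have [[x ->] [y ->]] := (qproj_surj c, qproj_surj d).
by exists (rdiv x y); rewrite /= coset_rdiv.
Qed.

(* The operations of X/N are the elementwise operations on cosets; by
   normality these give (xN)(yN) = (xy)N, and likewise for the divisions. *)
Definition quotient_mul (c d : quotient_loop) : quotient_loop :=
  QuotientLoop (quotient_mul_in c d).
Definition quotient_ldiv (c d : quotient_loop) : quotient_loop :=
  QuotientLoop (quotient_ldiv_in c d).
Definition quotient_rdiv (c d : quotient_loop) : quotient_loop :=
  QuotientLoop (quotient_rdiv_in c d).

HB.instance Definition _ := hasMul.Build quotient_loop quotient_mul.

Fact qprojM : {morph qproj : x y / x * y}.
Proof. by move=> x y; apply: quotient_set_inj; rewrite /= coset_mul. Qed.

Fact qproj_quotient_ldiv x y :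
  qproj (ldiv x y) = quotient_ldiv (qproj x) (qproj y).
Proof. by apply: quotient_set_inj; rewrite /= coset_ldiv. Qed.

Fact qproj_quotient_rdiv x y :
  qproj (rdiv x y) = quotient_rdiv (qproj x) (qproj y).
Proof. by apply: quotient_set_inj; rewrite /= coset_rdiv. Qed.

Fact quotient_mul1g : left_id (qproj 1) (@mul quotient_loop).
Proof. by move=> c; have [x ->] := qproj_surj c; rewrite -qprojM mul1g. Qed.

Fact quotient_mulg1 : right_id (qproj 1) (@mul quotient_loop).
Proof. by move=> c; have [x ->] := qproj_surj c; rewrite -qprojM mulg1. Qed.

HB.instance Definition _ :=
  Magma_isUMagma.Build quotient_loop quotient_mul1g quotient_mulg1.

Fact quotient_mulKld (c d : quotient_loop) : c * quotient_ldiv c d = d.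
Proof.
have [[x ->] [y ->]] := (qproj_surj c, qproj_surj d).
by rewrite -qproj_quotient_ldiv -qprojM mulKld.
Qed.

Fact quotient_ldivKm (c d : quotient_loop) : quotient_ldiv c (c * d) = d.
Proof.
have [[x ->] [y ->]] := (qproj_surj c, qproj_surj d).
by rewrite -qprojM -qproj_quotient_ldiv ldivKm.
Qed.

Fact quotient_rdivKm (c d : quotient_loop) : quotient_rdiv c d * d = c.
Proof.
have [[x ->] [y ->]] := (qproj_surj c, qproj_surj d).
by rewrite -qproj_quotient_rdiv -qprojM rdivKm.
Qed.

Fact quotient_mulKrd (c d : quotient_loop) : quotient_rdiv (c * d) d = c.
Proof.
have [[x ->] [y ->]] := (qproj_surj c, qproj_surj d).
by rewrite -qprojM -qproj_quotient_rdiv mulKrd.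
Qed.

HB.instance Definition _ := UMagma_isLoop.Build quotient_loop
  quotient_mulKld quotient_ldivKm quotient_rdivKm quotient_mulKrd.

Fact qproj_morphism : loop_morphism qproj.
Proof.
split=> //; [exact: qprojM | exact: qproj_quotient_ldiv |].
exact: qproj_quotient_rdiv.
Qed.

End QuotientLoop.

Arguments qproj {X} N x.

Section Subdirect.
Variables X1 X2 : loopType.

Definition subdirect_product (A : set (X1 * X2)) : Prop :=
  [/\ subloop A, fst @` A = [set: X1] & snd @` A = [set: X2]].

Definition lifted_graph (N1 : normalSubloop X1) (N2 : normalSubloop X2)
    (phi : quotient_loop N1 -> quotient_loop N2) : set (X1 * X2) :=
  [set x | phi (qproj N1 x.1) = qproj N2 x.2].

Definition lifted_isomorphism_graph (A : set (X1 * X2)) : Prop :=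
  exists (N1 : normalSubloop X1) (N2 : normalSubloop X2)
         (phi : quotient_loop N1 -> quotient_loop N2),
    loop_isomorphism phi /\ A = lifted_graph phi.

End Subdirect.

(* Main.v *)
(** A subdirect product is rectangular ([A x z], [A x' z], [A x' w] imply
    [A x w]), because [x * (y \ z)] is a Mal'cev term. Hence "sharing a partner
    in [A]" is a congruence on each factor; dividing out these congruences turns
    [A] into the graph of an isomorphism.

    For the second part, write [G = G(phi)]. If [X1 / N1] is abelian, then [G]
    is the kernel of [(x, y) |-> yN2 \ phi (xN1)]. Conversely, let [G] be the
    kernel of [f], and for [x] in [X1] pick [x'] with [(x, x')] in [G]. Then
    [f (a * x, x') = f (a, 1) = f (x * a, x')] and
    [f ((a * x) * y, x' * y') = f (a, 1) = f (a * (x * y), x' * y')], and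
    [f] separates the points of a fiber [X1 x {w}] that differ modulo [N1]. *)
From HB Require Import structures.
Require Import Defs.
From mathcomp Require Import all_boot.
From mathcomp Require Import boolp classical_sets.

Set Implicit Arguments.
Unset Strict Implicit.
Unset Printing Implicit Defensive.

Local Open Scope classical_set_scope.
Local Open Scope quotient_scope.
Local Open Scope group_scope.

(** * Cancellation in loops *)

Section LoopTheory.
Variable X : loopType.
Implicit Types x y z : X.

Lemma loop_mulgI x : injective (mul x).
Proof. by move=> y z e; rewrite -[y](ldivKm x) e ldivKm. Qed.

Lemma loop_mulIg x : injective (mul^~ x).
Proof. by move=> y z e; rewrite -[y](mulKrd _ x) e mulKrd. Qed.

Lemma ldivxx x : ldiv x x = 1.
Proof. by rewrite -[X in ldiv _ X]mulg1 ldivKm. Qed.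

Lemma ldiv_eq1 x y : ldiv x y = 1 <-> y = x.
Proof.
by split=> [e | ->]; [rewrite -(mulKld x y) e mulg1 | exact: ldivxx].
Qed.

End LoopTheory.

(** Cancellation in [Y] determines both divisions and the unit from the product. *)
Lemma mul_loop_morphism (X Y : loopType) (f : X -> Y) :
  {morph f : x y / x * y} -> loop_morphism f.
Proof.
move=> fM; split=> // [x y | x y |].
- by apply: (@loop_mulgI _ (f x)); rewrite -fM !mulKld.
- by apply: (@loop_mulIg _ (f y)); rewrite /= -fM !rdivKm.
- by apply: (@loop_mulgI _ (f 1)); rewrite -fM !mulg1.
Qed.

(** * Quotients of loops by congruences *)

Definition loop_congruence (X : loopType) (e : rel X) : Prop :=
  [/\ forall x x' y y', e x x' -> e y y' -> e (x * y) (x' * y'),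
      forall x x' y y', e x x' -> e y y' -> e (ldiv x y) (ldiv x' y')
    & forall x x' y y', e x x' -> e y y' -> e (rdiv x y) (rdiv x' y')].

Section CongruenceQuotient.
Variables (X : loopType) (e : equiv_rel X).
Hypothesis eP : loop_congruence e.

(** The proof of congruence is an argument of the type so that the loop structure, which depends on
    it, can be attached to the type. *)
Definition cong_quotient of loop_congruence e := {eq_quot e}.
Local Notation Q := (cong_quotient eP).

HB.instance Definition _ := Choice.on Q.

Definition cong_pi (x : X) : Q := \pi_({eq_quot e}) x.
Definition cong_repr (q : Q) : X := @repr X {eq_quot e} q.

Lemma cong_piP x y : cong_pi x = cong_pi y <-> e x y.
Proof. by split=> [/eqmodP | exy]; last exact/eqmodP. Qed.

Lemma cong_reprK q : cong_pi (cong_repr q) = q.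
Proof. exact: (@reprK X {eq_quot e}). Qed.

Lemma cong_repr_pi x : e (cong_repr (cong_pi x)) x.
Proof. by apply/cong_piP; rewrite cong_reprK. Qed.

Definition cong_mul (p q : Q) := cong_pi (cong_repr p * cong_repr q).
Definition cong_ldiv (p q : Q) := cong_pi (ldiv (cong_repr p) (cong_repr q)).
Definition cong_rdiv (p q : Q) := cong_pi (rdiv (cong_repr p) (cong_repr q)).

Lemma cong_pi_mul x y : cong_mul (cong_pi x) (cong_pi y) = cong_pi (x * y).
Proof. by have [eM _ _] := eP; apply/cong_piP/eM; apply: cong_repr_pi. Qed.

Lemma cong_pi_ldiv x y :
  cong_ldiv (cong_pi x) (cong_pi y) = cong_pi (ldiv x y).
Proof. by have [_ eL _] := eP; apply/cong_piP/eL; apply: cong_repr_pi. Qed.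

Lemma cong_pi_rdiv x y :
  cong_rdiv (cong_pi x) (cong_pi y) = cong_pi (rdiv x y).
Proof. by have [_ _ eR] := eP; apply/cong_piP/eR; apply: cong_repr_pi. Qed.

HB.instance Definition _ := hasMul.Build Q cong_mul.

Lemma cong_mul1g : left_id (cong_pi 1) (@mul Q).
Proof. by move=> q; rewrite -[q]cong_reprK [LHS]cong_pi_mul mul1g. Qed.

Lemma cong_mulg1 : right_id (cong_pi 1) (@mul Q).
Proof. by move=> q; rewrite -[q]cong_reprK [LHS]cong_pi_mul mulg1. Qed.

HB.instance Definition _ := Magma_isUMagma.Build Q cong_mul1g cong_mulg1.

Lemma cong_mulKld (p q : Q) : p * cong_ldiv p q = q.
Proof.
rewrite -[p]cong_reprK -[q]cong_reprK cong_pi_ldiv.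
by rewrite [LHS]cong_pi_mul mulKld.
Qed.

Lemma cong_ldivKm (p q : Q) : cong_ldiv p (p * q) = q.
Proof.
rewrite -[p]cong_reprK -[q]cong_reprK [X in cong_ldiv _ X]cong_pi_mul.
by rewrite cong_pi_ldiv ldivKm.
Qed.

Lemma cong_rdivKm (p q : Q) : cong_rdiv p q * q = p.
Proof.
rewrite -[p]cong_reprK -[q]cong_reprK cong_pi_rdiv.
by rewrite [LHS]cong_pi_mul rdivKm.
Qed.

Lemma cong_mulKrd (p q : Q) : cong_rdiv (p * q) q = p.
Proof.
rewrite -[p]cong_reprK -[q]cong_reprK [X in cong_rdiv X _]cong_pi_mul.
by rewrite cong_pi_rdiv mulKrd.
Qed.

HB.instance Definition _ := UMagma_isLoop.Build Q
  cong_mulKld cong_ldivKm cong_rdivKm cong_mulKrd.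

Lemma cong_pi_morphism : loop_morphism cong_pi.
Proof. by apply: mul_loop_morphism => x y; rewrite -cong_pi_mul. Qed.

End CongruenceQuotient.

(** * Cosets and normal subloops *)

Section QuotientProjection.
Variables (X : loopType) (N : normalSubloop X).

(** The cosets of a kernel are the nonempty fibers of the morphism. *)
Lemma qproj_eq (Y : loopType) (f : X -> Y) :
    loop_morphism f -> (N : set X) = loop_kernel f ->
  forall x y, qproj N x = qproj N y <-> f x = f y.
Proof.
move=> fP NE x y; split=> [/(congr1 (@quotient_set _ N)) /= | fxy].
  rewrite !(coset_fiber fP NE) => xy.
  by have : [set z | f z = f x] x by []; rewrite xy.
by apply: quotient_set_inj; rewrite /= !(coset_fiber fP NE) fxy.
Qed.

Lemma qproj_morphism_isomorphism (Y : loopType) (g : quotient_loop N -> Y) :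
    {morph g \o qproj N : x y / x * y} -> injective g ->
    (forall y, exists x, g (qproj N x) = y) ->
  loop_isomorphism g.
Proof.
move=> gM gI gS; split.
  apply: mul_loop_morphism => c d.
  have [[x ->] [y ->]] := (qproj_surj c, qproj_surj d).
  by rewrite -qprojM; apply: gM.
have [h hK] := choice gS.
exists (fun y => qproj N (h y)) => [c | y]; last exact: hK.
by apply: gI; apply: hK.
Qed.

End QuotientProjection.

(** The subloop is the class of [1], the kernel of the projection modulo [R]; its cosets are the
    classes of [R]. *)
Lemma congruence_normalSubloop (X : loopType) (R : X -> X -> Prop) :
    (forall x, R x x) -> (forall x y, R x y -> R y x) ->
    (forall x y z, R x y -> R y z -> R x z) ->
    loop_congruence (fun x y => `[< R x y >]) ->
  exists N : normalSubloop X, forall x y, qproj N x = qproj N y <-> R x y.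
Proof.
move=> Rr Rs Rt Rc.
pose r x y := `[< R x y >].
have r_refl : reflexive r by move=> x; apply/asboolP.
have r_sym : symmetric r by move=> x y; apply/asboolP/asboolP; apply: Rs.
have r_trans : transitive r.
  by move=> y x z /asboolP xy /asboolP yz; apply/asboolP/(Rt _ y).
pose e := EquivRel r r_refl r_sym r_trans.
have eP : loop_congruence e by [].
have fP := cong_pi_morphism eP.
have NP : normal_subloop (loop_kernel (cong_pi eP)).
  by exists (cong_quotient eP), (cong_pi eP).
exists (NormalSubloop NP) => x y; rewrite (qproj_eq fP) // cong_piP.
by split=> /asboolP.
Qed.

(** * Subdirect products as binary relations *)

Section SubdirectRelation.
Variables (X Y : loopType) (P : X -> Y -> Prop).

(** Written as a relation, the notion is visibly symmetric in the two factors, so results about the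
    first factor transfer to the second. *)
Definition subdirect_relation : Prop :=
  [/\ forall x x' y y', P x y -> P x' y' -> P (x * x') (y * y'),
      forall x x' y y', P x y -> P x' y' -> P (ldiv x x') (ldiv y y'),
      forall x x' y y', P x y -> P x' y' -> P (rdiv x x') (rdiv y y'),
      forall x, exists y, P x y
    & forall y, exists x, P x y].

Hypothesis PP : subdirect_relation.

Lemma subdirect_rectangular x x' y y' : P x y -> P x' y -> P x' y' -> P x y'.
Proof.
have [PM PL _ _ _] := PP; move=> xy x'y x'y'.
(* The first coordinate is [x * ldiv x' x' = x], the second is [y * ldiv y y' = y']. *)
by have := PM _ _ _ _ xy (PL _ _ _ _ x'y x'y'); rewrite ldivxx mulg1 mulKld.
Qed.

(** Rectangularity gives transitivity of sharing a partner; closure of [P] gives compatibility with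
    the operations. *)
Lemma subdirect_congruence :
  exists N : normalSubloop X,
    forall x x', qproj N x = qproj N x' <-> exists y, P x y /\ P x' y.
Proof.
have [PM PL PR PX _] := PP.
apply: congruence_normalSubloop.
- by move=> x; have [y xy] := PX x; exists y.
- by move=> x x' [y [xy x'y]]; exists y.
- move=> x x' x'' [y [xy x'y]] [y' [x'y' x''y']]; exists y'; split=> //.
  exact: subdirect_rectangular xy x'y x'y'.
- split=> x x' z z' /asboolP[y [xy x'y]] /asboolP[t [zt z't]]; apply/asboolP.
  + by exists (y * t); split; apply: PM.
  + by exists (ldiv y t); split; apply: PL.
  + by exists (rdiv y t); split; apply: PR.
Qed.

End SubdirectRelation.

(** * From subdirect products to lifted isomorphism graphs *)

Section Proposition.
Variables X1 X2 : loopType.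

Lemma subdirect_relationC (P : X1 -> X2 -> Prop) :
  subdirect_relation P -> subdirect_relation (fun y x => P x y).
Proof.
move=> [PM PL PR P1 P2]; split=> // y y' x x'.
- exact: PM.
- exact: PL.
- exact: PR.
Qed.

Lemma subdirect_productP (A : set (X1 * X2)) :
  subdirect_product A <-> subdirect_relation (fun x y => A (x, y)).
Proof.
split=> [[[A1 AM AL AR] A_fst A_snd] | [AM AL AR A_fst A_snd]].
  split=> [x x' y y' xy | x x' y y' xy | x x' y y' xy | x | y].
  - exact: AM xy.
  - exact: AL xy.
  - exact: AR xy.
  - have [[z y] Azy <-] : (fst @` A) x by rewrite A_fst.
    by exists y.
  - have [[x z] Axz <-] : (snd @` A) y by rewrite A_snd.
    by exists x.
split; first split.
- have [y Ay] := A_fst 1.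
  by have := AL _ _ _ _ Ay Ay; rewrite !ldivxx.
- by move=> [x y] [x' y']; apply: AM.
- by move=> [x y] [x' y']; apply: AL.
- by move=> [x y] [x' y']; apply: AR.
- apply/seteqP; split=> // x _; have [y xy] := A_fst x.
  by exists (x, y).
- apply/seteqP; split=> // y _; have [x xy] := A_snd y.
  by exists (x, y).
Qed.

Lemma subdirect_lifted (A : set (X1 * X2)) :
  subdirect_product A -> lifted_isomorphism_graph A.
Proof.
move=> /subdirect_productP AP; have [AM _ _ A1 A2] := AP.
have rect := subdirect_rectangular AP.
have [N1 N1P] := subdirect_congruence AP.
have [N2 N2P] := subdirect_congruence (subdirect_relationC AP).
(* A coset is sent to the coset of some partner of one of its elements; [phiE] shows that the choice
   does not matter. *)
have /choice[phi phiA] (c : quotient_loop N1) :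
    exists d x y, [/\ c = qproj N1 x, A (x, y) & d = qproj N2 y].
  have [x ->] := qproj_surj c; have [y xy] := A1 x.
  by exists (qproj N2 y), x, y.
have phiE x y : A (x, y) -> phi (qproj N1 x) = qproj N2 y.
  move=> xy; have [x' [y' [/N1P[z [xz x'z]] x'y' ->]]] := phiA (qproj N1 x).
  (* By rectangularity [x] is also a partner of [y'], hence a common partner of [y'] and [y]. *)
  apply/N2P; exists x; split=> //.
  exact: rect xz x'z x'y'.
have graphA x y : phi (qproj N1 x) = qproj N2 y -> A (x, y).
  have [y' xy'] := A1 x; rewrite (phiE _ _ xy') => /N2P[x' [x'y' x'y]].
  exact: rect xy' x'y' x'y.
exists N1, N2, phi; split; last first.
  by apply/seteqP; split=> -[x y]; [apply: phiE | apply: graphA].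
apply: qproj_morphism_isomorphism => [x x' | c c' | d].
- have [[y xy] [y' xy']] := (A1 x, A1 x').
  by rewrite /= (phiE _ _ xy) (phiE _ _ xy') -qprojM; apply/phiE/AM.
- have [[x ->] [x' ->]] := (qproj_surj c, qproj_surj c').
  have [y x'y] := A1 x'; rewrite (phiE _ _ x'y) => /graphA xy.
  by apply/N1P; exists y.
- have [y ->] := qproj_surj d; have [x xy] := A2 y.
  by exists x; apply: phiE.
Qed.

(** * Lifted isomorphism graphs: subdirectness and normality *)

Section LiftedGraph.
Variables (N1 : normalSubloop X1) (N2 : normalSubloop X2).
Variable phi : quotient_loop N1 -> quotient_loop N2.
Hypothesis phiP : loop_isomorphism phi.

Lemma lifted_graph_fst x : exists y, lifted_graph phi (x, y).
Proof. by have [y] := qproj_surj (phi (qproj N1 x)); exists y. Qed.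

Lemma lifted_subdirect : subdirect_product (lifted_graph phi).
Proof.
have [[phiM phiL phiR _] [psi _ psiK]] := phiP.
have [pM1 pL1 pR1 _] := qproj_morphism N1.
have [pM2 pL2 pR2 _] := qproj_morphism N2.
apply/subdirect_productP; split; rewrite /lifted_graph /=.
- by move=> x x' y y' xy xy'; rewrite pM1 phiM xy xy' pM2.
- by move=> x x' y y' xy xy'; rewrite pL1 phiL xy xy' pL2.
- by move=> x x' y y' xy xy'; rewrite pR1 phiR xy xy' pR2.
- exact: lifted_graph_fst.
- move=> y; have [x xE] := qproj_surj (psi (qproj N2 y)).
  by exists x; rewrite -xE psiK.
Qed.

Lemma abelian_lifted_graph_normal :
  abelian_loop (quotient_loop N1) -> normal_subloop (lifted_graph phi).
Proof.
have [[phiM _ _ _] [psi phiK psiK]] := phiP; move=> [mulA1 mulC1].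
(* Both laws pass to [X2 / N2] because [phi] is a surjective morphism. *)
have mulA2 : associative (@mul (quotient_loop N2)).
  by move=> a b c; rewrite -[a]psiK -[b]psiK -[c]psiK -!phiM mulA1.
have mulC2 : commutative (@mul (quotient_loop N2)).
  by move=> a b; rewrite -[a]psiK -[b]psiK -!phiM mulC1.
exists (quotient_loop N2).
exists (fun p => ldiv (qproj N2 p.2) (phi (qproj N1 p.1))); split.
  apply: mul_loop_morphism => -[x y] [x' y'] /=; rewrite !qprojM phiM.
  move: (qproj N2 y) (qproj N2 y') (phi _) (phi _) => a b v u.
  (* After multiplication by [a * b], it remains to regroup [(a * b) * (ldiv a u * ldiv b v)] into
     [u * v]. *)
  apply: (@loop_mulgI _ (a * b)); rewrite mulKld -mulA2.
  by rewrite [ldiv a u * _]mulC2 [b * _]mulA2 mulKld [v * _]mulC2 mulA2 mulKld.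
by apply/seteqP; split=> -[x y]; rewrite /lifted_graph /loop_kernel /= ldiv_eq1.
Qed.

Lemma lifted_graph_normal_abelian :
  normal_subloop (lifted_graph phi) -> abelian_loop (quotient_loop N1).
Proof.
have [[_ _ _ phi1] /bij_inj phiI] := phiP; move=> [Y [f [[fM fL _ _] kerf]]].
have [_ pL1 _ p1] := qproj_morphism N1.
have [_ _ _ p2] := qproj_morphism N2.
have f1 x y : lifted_graph phi (x, y) -> f (x, y) = 1 by rewrite kerf.
(* The element [ldiv (u, w) (v, w) = (ldiv u v, 1)] lies in the kernel, that is, in the graph, so
   [phi] maps the coset of [ldiv u v] to [1]; injectivity of [phi] concludes. *)
have fiber_inj w u v : f (u, w) = f (v, w) -> qproj N1 u = qproj N1 v.
  move=> fuv; apply/esym/ldiv_eq1/phiI; rewrite phi1 -pL1 -p2 -(ldivxx w).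
  change (lifted_graph phi (ldiv (u, w) (v, w))).
  by rewrite kerf /loop_kernel /= fL fuv ldivxx.
split=> [c d e | c d].
- have [[[a ->] [x ->]] [y ->]] := (qproj_surj c, qproj_surj d, qproj_surj e).
  have [[x' xx'] [y' yy']] := (lifted_graph_fst x, lifted_graph_fst y).
  rewrite -!qprojM; apply: (fiber_inj (x' * y')).
  (* Since [a] is paired with [1], both bracketings have second coordinate [x' * y'] and are
     comparable in one fiber; [f] sends [(x, x')] and [(y, y')] to [1]. *)
  have -> : (a * (x * y), x' * y') = (a, 1) * ((x, x') * (y, y')).
    by congr pair; rewrite /= mul1g.
  have -> : (a * x * y, x' * y') = (a, 1) * (x, x') * (y, y').
    by congr pair; rewrite /= mul1g.
  by rewrite !fM (f1 x) // (f1 y) // !mulg1.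
- have [[a ->] [x ->]] := (qproj_surj c, qproj_surj d).
  have [x' xx'] := lifted_graph_fst x.
  rewrite -!qprojM; apply: (fiber_inj x').
  have -> : (a * x, x') = (a, 1) * (x, x') by congr pair; rewrite /= mul1g.
  have -> : (x * a, x') = (x, x') * (a, 1) by congr pair; rewrite /= mulg1.
  by rewrite !fM (f1 x) // mul1g mulg1.
Qed.

End LiftedGraph.
End Proposition.

Theorem proposition3p4 (X1 X2 : loopType) :
  (forall A : set (X1 * X2),
     subdirect_product A <-> lifted_isomorphism_graph A) /\
  (forall (N1 : normalSubloop X1) (N2 : normalSubloop X2)
          (phi : quotient_loop N1 -> quotient_loop N2),
     loop_isomorphism phi ->
     (normal_subloop (lifted_graph phi) <-> abelian_loop (quotient_loop N1))).
Proof.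
split=> [A | N1 N2 phi phiP]; split.
- exact: subdirect_lifted.
- by move=> [N1 [N2 [phi [phiP ->]]]]; apply: lifted_subdirect.
- exact: lifted_graph_normal_abelian.
- exact: abelian_lifted_graph_normal.
Qed.
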